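(* Let $c>2$ and set $\alpha=c-2$. Let $i,j\in\{+,-\}$, let $\Lambda$ be a diamond domain and let $\Delta=\Delta(\Lambda)$. Then the probability measure $\mathsf P^{ij}_{\Lambda,\alpha}$ on $\Omega^{\mathsf{spin},ij}_\Lambda\times\Omega^{\mathsf{SI},11}_\Delta$ given by $$\mathsf P^{ij}_{\Lambda,\alpha}(\sigma,\eta)=\frac1{\mathsf Z^{ij}_{\Lambda,\alpha}}\,\alpha^{N_\Delta(\eta)}\,\mathbf 1_{\{\sigma\sim\eta\}}$$ (with $\mathsf Z^{ij}_{\Lambda,\alpha}$ the normalizing constant) is a coupling between $\mathbb P^{\mathsf{spin},ij}_{\Lambda,c}$ and $\mathbb P^{\mathsf{SI},11}_{\Delta,\alpha,2}$. Moreover, if $(\sigma,\eta)$ is sampled from this coupling, then \begin{itemize} \item given $\sigma$, $\eta$ can be sampled by first putting in the unique compatible edge at each non-saddle point, and then, independently for each saddle point in $\mathrm{saddle}_\Lambda(\sigma)$, assigning one of the three values $(1,0),(1,1),(0,1)$ for $\hat\eta$ with probabilities $\frac1{2+\alpha},\frac\alpha{2+\alpha},\frac1{2+\alpha}$, respectively (at all vertices of $\mathbb Z^2$ that are not internal vertices of $\hat\Lambda$, $\hat\eta$ equals $(1,1)$ by the boundary condition); \item given $\eta$, $\sigma$ can be sampled by independently choosing a uniform sign for each non-boundary cluster, while the two boundary clusters receive the spin prescribed by the boundary condition (i.e. $i$ for the dual boundary cluster and $j$ for the primal boundary cluster). \end{itemize}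
   Context: Lattices: $(\mathbb Z^2)^*$ is the dual lattice of $\mathbb Z^2$, i.e. the square lattice $\mathbb Z^2+(\frac12,\frac12)$ whose vertices are the faces of $\mathbb Z^2$, with nearest-neighbour adjacency. It is bipartite; $\mathbb L$ (even, primal) and $\mathbb L^*$ (odd, dual) denote its two bipartition classes, each regarded as a graph isomorphic to the square lattice, two of its vertices being adjacent when they are the faces at diagonally opposite corners of a vertex of $\mathbb Z^2$; the edge sets are $E(\mathbb L),E(\mathbb L^* )$. Each $x\in\mathbb Z^2$ is the midpoint of exactly one $e_x\in E(\mathbb L)$ and exactly one $e_x^*\in E(\mathbb L^* )$, dual to each other; $\{e_x,e_x^*\}$ is the cross at $x$. Domains: a diamond domain is $\Lambda=\{u\in(\mathbb Z^2)^*:\mathrm{dist}(u,v)\le n\}$ with $v\in\mathbb L$ and $n$ a positive even integer (graph distance in $(\mathbb Z^2)^*$). Its inner boundary is $\{u:\mathrm{dist}(u,v)=n\}\subset\mathbb L$, and its outer boundary is $\{u:\mathrm{dist}(u,v)=n+1\}\subset\mathbb L^*$. $\partial^\dagger\Lambda$ is the simple circuit in $\mathbb Z^2$ separating inner from outer boundary vertices, and $\hat\Lambda$ is the subgraph of $\mathbb Z^2$ induced by the vertices on or enclosed by $\partial^\dagger\Lambda$. Internal vertices of $\hat\Lambda$ are those whose four incident edges of $\mathbb Z^2$ all belong to $\hat\Lambda$. $\Delta(\Lambda)$ is the set of edges of $\mathbb L$ with both endpoints in $\Lambda$, together with their dual edges. Spin representation of the six-vertex model: $\sigma\in\{+,-\}^{(\mathbb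 Z^2)^*}$ satisfies the ice rule if at every $x\in\mathbb Z^2$, $\sigma$ is constant on at least one of $e_x,e_x^*$ (the two diagonals of the four faces around $x$); $x$ is a saddle point if $\sigma$ is constant on both. $\Omega^{\mathsf{spin},ij}_\Lambda$ is the set of $\sigma$ satisfying the ice rule with spin $i$ on outer boundary vertices, spin $j$ on inner boundary vertices, and, everywhere outside $\Lambda$, spin $i$ on $\mathbb L^*$ and spin $j$ on $\mathbb L$. $\mathrm{saddle}_\Lambda(\sigma)$ is the set of internal vertices of $\hat\Lambda$ which are saddle points. $\mathbb P^{\mathsf{spin},ij}_{\Lambda,c}(\sigma)=\frac1Z c^{\#\mathrm{saddle}_\Lambda(\sigma)}\mathbf 1_{\Omega^{\mathsf{spin},ij}_\Lambda}(\sigma)$. Superimposed model: $\Omega^{\mathsf{SI}}$ is the set of $\eta=(\eta^0,\eta^1)\in\{0,1\}^{E(\mathbb L)}\times\{0,1\}^{E(\mathbb L^* )}$ having no closed crosses, where a cross $\{e,e^*\}$ is closed if $\eta^0_e=\eta^1_{e^*}=0$ and open if $\eta^0_e=\eta^1_{e^*}=1$. Write $\hat\eta_x=(\eta^0_{e_x},\eta^1_{e_x^*})\in\{(1,0),(1,1),(0,1)\}$. For $\alpha,q>0$, finite $\Delta\subset E(\mathbb L)\cup E(\mathbb L^* )$ and $\tau\in\Omega^{\mathsf{SI}}$, $\mathbb P^{\mathsf{SI},\tau}_{\Delta,\alpha,q}(\eta)=\frac1Z\alpha^{N_\Delta(\eta)}q^{k_\Delta(\eta)}\mathbf 1_{\Omega^{\mathsf{SI},\tau}_\Delta}(\eta)$,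 where $\Omega^{\mathsf{SI},\tau}_\Delta$ is the set of $\eta\in\Omega^{\mathsf{SI}}$ agreeing with $\tau$ outside $\Delta$, $N_\Delta(\eta)$ is the number of open crosses having at least one edge in $\Delta$, and $k_\Delta(\eta)$ is the total number of clusters (connected components of $(\mathbb L,\eta^0)$ and of $(\mathbb L^*,\eta^1)$) containing a vertex incident to $\Delta$. The superscript $11$ denotes the wired-wired boundary condition $\tau$ in which all edges are open. Compatibility: $\sigma\sim\eta$ means $\sigma_u=\sigma_v$ for every $e=\{u,v\}\in E(\mathbb L)\cup E(\mathbb L^* )$ with $\eta_e=1$. At a non-saddle point $x$, the unique compatible edge is the one of $e_x,e_x^*$ on which $\sigma$ is constant (it is open and the other is closed). For $\eta\in\Omega^{\mathsf{SI},11}_\Delta$, the primal (dual) boundary cluster is the cluster of $\eta^0$ (of $\eta^1$) containing the inner (outer) boundary vertices of $\Lambda$ and the vertices of $\mathbb L$ (of $\mathbb L^*$) outside $\Lambda$. *)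

(* Defs.v *)
From HB Require Import structures.
From Stdlib Require Import Relation_Operators.
From mathcomp Require Import all_boot all_order all_algebra finmap.
From mathcomp Require Import zify.
From mathcomp Require Import boolp classical_sets functions cardinality fsbigop.
From mathcomp Require Import reals numfun.

Set Implicit Arguments.
Unset Strict Implicit.
Unset Printing Implicit Defensive.

Import Order.TTheory GRing.Theory Num.Theory.

Local Open Scope classical_set_scope.
Local Open Scope ring_scope.

(* All configuration spaces below are infinite, but every law is supported on a
finite set; a law is represented by its probability mass function.  A sum over
[setT] with infinite support is 0 by convention in [fsbigop], so the second
clause of [is_pmf] also forces the support of [P] to be finite. *)

Definition is_pmf (R : realType) (T : choiceType) (P : T -> R) : Prop :=
  (forall x, 0 <= P x) /\ \sum_(x \in setT) P x = 1.

Definition normalize (R : realType) (T : choiceType) (w : T -> R) : T -> R :=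
  fun x => (\sum_(y \in setT) w y)^-1 * w x.

Definition pmf_map (R : realType) (T U : choiceType) (f : T -> U) (P : T -> R) :
    U -> R :=
  fun y => \sum_(x \in f @^-1` [set y]) P x.

Definition is_coupling (R : realType) (T U : choiceType)
    (P : T * U -> R) (mu : T -> R) (nu : U -> R) : Prop :=
  [/\ is_pmf P, pmf_map fst P =1 mu & pmf_map snd P =1 nu].

Definition cond_snd (R : realType) (T U : choiceType) (P : T * U -> R) (x : T) :
    U -> R :=
  fun y => P (x, y) / pmf_map fst P x.

Definition cond_fst (R : realType) (T U : choiceType) (P : T * U -> R) (y : U) :
    T -> R :=
  fun x => P (x, y) / pmf_map snd P y.

(* The law of a family indexed by [I] whose coordinates in the finite set [A]
   are independent with law [p]; the other coordinates, which carry no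
   randomness, are pinned to the dummy value [s0]. *)
Definition prod_pmf (R : realType) (I S : choiceType) (A : set I) (s0 : S)
    (p : S -> R) : (I -> S) -> R :=
  fun f => \1_[set g : I -> S | forall x, ~ A x -> g x = s0] f
           * \big[*%R/1]_(x \in A) p (f x).

Notation Z2 := (int * int)%type.

(* Vertices of (Z^2)^*: the pair (a, b) stands for the face with center
   (a + 1/2, b + 1/2), that is, the face whose lower left corner is (a, b). *)
Notation face := (int * int)%type.

(* Nearest-neighbour adjacency, both on Z^2 and on (Z^2)^*. *)
Definition nn (x y : int * int) : bool :=
  `|x.1 - y.1| + `|x.2 - y.2| == 1.

(* The two bipartition classes: [primal] is L, its complement is L^*. *)
Definition primal (u : face) : bool := (2 %| u.1 + u.2)%Z.

Definition face_ne (x : Z2) : face := x.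
Definition face_nw (x : Z2) : face := (x.1 - 1, x.2).
Definition face_sw (x : Z2) : face := (x.1 - 1, x.2 - 1).
Definition face_se (x : Z2) : face := (x.1, x.2 - 1).

Definition faces_at (x : Z2) : set face :=
  [set face_ne x; face_nw x; face_sw x; face_se x].

(* Edges of L and of L^* are named by their midpoints: [Primal x] is e_x and
   [Dual x] is e_x^*.  See [ends_inj], [ends_parity] and [ends_diag]. *)
Inductive edge := Primal of Z2 | Dual of Z2.

Definition mid (d : edge) : Z2 :=
  match d with Primal x => x | Dual x => x end.

Definition ends (d : edge) : set face :=
  match d with
  | Primal x => if primal (face_ne x) then [set face_ne x; face_sw x]
                else [set face_nw x; face_se x]
  | Dual x => if primal (face_ne x) then [set face_nw x; face_se x]
              else [set face_ne x; face_sw x]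
  end.

Lemma ends_parity (d : edge) (u : face) :
  ends d u -> primal u = if d is Primal _ then true else false.
Proof.
case: d => -[a b]; rewrite /ends; case: ifP;
  rewrite /primal /face_ne /face_nw /face_sw /face_se /= => h [] -> /=; lia.
Qed.

Lemma ends_inj : injective ends.
Proof.
move=> d d' E.
have dd' u : ends d u -> ends d' u by rewrite E.
have d'd u : ends d' u -> ends d u by rewrite E.
have : exists u, ends d u.
  by case: d {E dd' d'd} => x /=; case: ifP => _; eexists; left; reflexivity.
case=> u du; have := ends_parity (dd' _ du); rewrite (ends_parity du) {u du}.
have pairP (p q r : face) : [set p; q] r ->
    (r.1 = p.1 /\ r.2 = p.2) \/ (r.1 = q.1 /\ r.2 = q.2).
  by case=> ->; [left|right].
case: d d' E dd' d'd => -[a b] [] [a' b'] _ //=;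
  rewrite /face_ne /face_nw /face_sw /face_se /=;
  case: ifP => h; case: ifP => h' dd' d'd _;
  have /pairP/= k1 := dd' _ (or_introl erefl);
  have /pairP/= k2 := dd' _ (or_intror erefl);
  have /pairP/= k3 := d'd _ (or_introl erefl);
  have /pairP/= k4 := d'd _ (or_intror erefl);
  (congr (Primal (_, _)) || congr (Dual (_, _)));
  move: h h'; rewrite /primal /=; lia.
Qed.

Lemma ends_diag (u w : face) :
  (`|u.1 - w.1| == 1) && (`|u.2 - w.2| == 1)
  <-> u != w /\ exists d, ends d = [set u; w].
Proof.
case: u w => [u1 u2] [w1 w2] /=; split; last first.
  case=> uw [d E].
  have uE : ends d (u1, u2) by rewrite E; left.
  have wE : ends d (w1, w2) by rewrite E; right.
  case: d {E} uE wE uw => -[a b] /=;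
    rewrite /face_ne /face_nw /face_sw /face_se /=; case: ifP => _;
    by do 2 (case=> -[-> ->]); rewrite ?eqxx //= => _; lia.
move=> h; split; first by apply/eqP => -[] *; lia.
pose x : Z2 := (Num.max u1 w1, Num.max u2 w2).
have [d1 d2] : `|u1 - w1| = 1 /\ `|u2 - w2| = 1 by move: h; lia.
have E : [set face_ne x; face_sw x] = [set (u1, u2); (w1, w2)]
      \/ [set face_nw x; face_se x] = [set (u1, u2); (w1, w2)].
  rewrite /x /face_ne /face_nw /face_sw /face_se /=.
  have [a|b] := leP u1 w1; have [a'|b'] := leP u2 w2.
  - left; rewrite setUC; congr ([set (_, _); (_, _)]); lia.
  - right; congr ([set (_, _); (_, _)]); lia.
  - right; rewrite setUC; congr ([set (_, _); (_, _)]); lia.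
  - left; congr ([set (_, _); (_, _)]); lia.
case: (boolP (primal (face_ne x))) E => p [] E.
- by exists (Primal x); rewrite /= p.
- by exists (Dual x); rewrite /= p.
- by exists (Dual x); rewrite /= (negbTE p).
- by exists (Primal x); rewrite /= (negbTE p).
Qed.

(* [dist u v k]: the graph distance between u and v in (Z^2)^* is k. *)
Definition dist (u v : face) (k : nat) : Prop :=
  (exists2 p : seq face, path nn u p & last u p = v /\ size p = k)
  /\ forall p : seq face, path nn u p -> last u p = v -> (k <= size p)%N.

Record diamond := Diamond {
  center : face;
  radius : nat;
  center_primal : primal center;
  radius_gt0 : (0 < radius)%N;
  radius_even : ~~ odd radius }.

Definition domain (D : diamond) : set face :=
  [set u | exists2 k, (k <= radius D)%N & dist u (center D) k].

Definition inner_boundary (D : diamond) : set face :=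
  [set u | dist u (center D) (radius D)].

Definition outer_boundary (D : diamond) : set face :=
  [set u | dist u (center D) (radius D).+1].

(* The circuit separating the inner from the outer boundary consists of the
   edges {x, y} of Z^2 which have an inner boundary face on one side and an
   outer boundary face on the other. *)
Definition circuit_edge (D : diamond) (x y : Z2) : Prop :=
  nn x y /\ exists u w, [/\ inner_boundary D u, outer_boundary D w,
    faces_at x u /\ faces_at x w & faces_at y u /\ faces_at y w].

Definition on_circuit (D : diamond) : set Z2 :=
  [set x | exists y, circuit_edge D x y].

(* A vertex is enclosed by the circuit if its component in Z^2 minus the
   vertices of the circuit is bounded. *)
Definition enclosed (D : diamond) : set Z2 :=
  [set x | ~ on_circuit D x /\
    finite_set [set y |
      clos_refl_trans Z2 (fun a b => nn a b /\ ~ on_circuit D b) x y]].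

Definition hat_vertex (D : diamond) : set Z2 := on_circuit D `|` enclosed D.

Definition hat_edge (D : diamond) (x y : Z2) : Prop :=
  [/\ nn x y, hat_vertex D x & hat_vertex D y].

Definition internal (D : diamond) : set Z2 :=
  [set x | hat_vertex D x /\ forall y, nn x y -> hat_edge D x y].

(* The set of edges Delta(Lambda); note that [Primal (mid d)] is the primal
   edge of the cross containing d. *)
Definition Delta (D : diamond) : set edge :=
  [set d | ends (Primal (mid d)) `<=` domain D].

(* [true] is the spin +, [false] is the spin -. *)
Notation spin_config := (face -> bool).

Definition constant_on (s : spin_config) (A : set face) : Prop :=
  forall u w, A u -> A w -> s u = s w.

Definition ice_rule (s : spin_config) : Prop :=
  forall x, constant_on s (ends (Primal x)) \/ constant_on s (ends (Dual x)).

Definition saddle_point (s : spin_config) : set Z2 :=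
  [set x | constant_on s (ends (Primal x)) /\ constant_on s (ends (Dual x))].

Definition Omega_spin (D : diamond) (i j : bool) : set spin_config :=
  [set s | [/\ ice_rule s,
    forall u, outer_boundary D u -> s u = i,
    forall u, inner_boundary D u -> s u = j &
    forall u, ~ domain D u -> s u = if primal u then j else i]].

Definition saddle (D : diamond) (s : spin_config) : set Z2 :=
  internal D `&` saddle_point s.

Definition P_spin (R : realType) (D : diamond) (i j : bool) (c : R) :
    spin_config -> R :=
  normalize (fun s => c ^+ #|` fset_set (saddle D s)|
                      * \1_(Omega_spin D i j) s).

(* The pair (eta^0, eta^1) is encoded as a single function on the disjoint
   union of E(L) and E(L^* ). *)
Notation SI_config := (edge -> bool).

Definition hat (e : SI_config) (x : Z2) : bool * bool :=
  (e (Primal x), e (Dual x)).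

Definition Omega_SI : set SI_config :=
  [set e | forall x, hat e x <> (false, false)].

Definition Omega_SI_bc (De : set edge) (t : SI_config) : set SI_config :=
  [set e | Omega_SI e /\ forall d, ~ De d -> e d = t d].

Definition open_adj (e : SI_config) (u w : face) : Prop :=
  exists d, [/\ e d, ends d u & ends d w].

(* Edges never join L to L^*, so this is the component of u in (L, eta^0) if u
   is primal, and its component in (L^*, eta^1) otherwise. *)
Definition cluster (e : SI_config) (u : face) : set face :=
  [set w | clos_refl_trans face (open_adj e) u w].

Definition open_crosses (De : set edge) (e : SI_config) : set Z2 :=
  [set x | hat e x = (true, true) /\ (De (Primal x) \/ De (Dual x))].

Definition incident_clusters (De : set edge) (e : SI_config) : set (set face) :=
  [set C | exists u d, [/\ De d, ends d u & C = cluster e u]].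

Definition P_SI (R : realType) (De : set edge) (t : SI_config) (alpha q : R) :
    SI_config -> R :=
  normalize (fun e => alpha ^+ #|` fset_set (open_crosses De e)|
                      * q ^+ #|` fset_set (incident_clusters De e)|
                      * \1_(Omega_SI_bc De t) e).

Definition wired : SI_config := fun _ => true.

Definition compatible (s : spin_config) (e : SI_config) : Prop :=
  forall d, e d -> constant_on s (ends d).

Definition P_joint (R : realType) (D : diamond) (i j : bool) (alpha : R) :
    spin_config * SI_config -> R :=
  normalize (fun se => alpha ^+ #|` fset_set (open_crosses (Delta D) se.2)|
    * \1_[set se' : spin_config * SI_config |
           [/\ Omega_spin D i j se'.1, Omega_SI_bc (Delta D) wired se'.2 &
               compatible se'.1 se'.2]] se).

Definition saddle_law (R : realType) (alpha : R) (b : bool * bool) : R :=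
  match b with
  | (true, false) => 1 / (2 + alpha)
  | (true, true) => alpha / (2 + alpha)
  | (false, true) => 1 / (2 + alpha)
  | (false, false) => 0
  end.

(* The configuration eta built from sigma and from the values [f x] chosen at
   the points x of saddle(sigma). *)
Definition fill_hat (D : diamond) (s : spin_config) (f : Z2 -> bool * bool)
    (x : Z2) : bool * bool :=
  if x \notin saddle_point s then
    if `[< constant_on s (ends (Primal x)) >] then (true, false)
    else (false, true)
  else if x \in internal D then f x
  else (true, true).

Definition fill_edges (D : diamond) (s : spin_config) (f : Z2 -> bool * bool) :
    SI_config :=
  fun d => match d with
           | Primal x => (fill_hat D s f x).1
           | Dual x => (fill_hat D s f x).2
           end.

Definition primal_boundary_cluster (D : diamond) (e : SI_config)
    (C : set face) : Prop :=
  [/\ exists2 u, primal u & C = cluster e u, inner_boundary D `<=` C &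
      forall u, primal u -> ~ domain D u -> C u].

Definition dual_boundary_cluster (D : diamond) (e : SI_config)
    (C : set face) : Prop :=
  [/\ exists2 u, ~~ primal u & C = cluster e u, outer_boundary D `<=` C &
      forall u, ~~ primal u -> ~ domain D u -> C u].

Definition free_clusters (D : diamond) (e : SI_config) : set (set face) :=
  [set C | [/\ exists u, C = cluster e u, ~ primal_boundary_cluster D e C &
              ~ dual_boundary_cluster D e C]].

(* The configuration sigma built from eta and from the signs [f C] chosen on
   the non-boundary clusters C. *)
Definition color_clusters (D : diamond) (i j : bool) (e : SI_config)
    (f : set face -> bool) : spin_config :=
  fun u => let C := cluster e u in
    if `[< primal_boundary_cluster D e C >] then j
    else if `[< dual_boundary_cluster D e C >] then i
    else f C.

(* Main.v *)
Require Import Defs.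
From Stdlib Require Import Relation_Operators.
From mathcomp Require Import all_boot all_order all_algebra.
From mathcomp Require Import finmap zify ring.
From mathcomp Require Import boolp classical_sets functions cardinality fsbigop.
From mathcomp Require Import reals numfun.

Set Implicit Arguments.
Unset Strict Implicit.
Unset Printing Implicit Defensive.

Import Order.TTheory GRing.Theory Num.Theory.
Local Open Scope classical_set_scope.
Local Open Scope ring_scope.

(** The weight of a pair (sigma, eta) is alpha ^ N(eta) on compatible pairs.
Everything follows from factorising this weight in two ways.

Fix sigma.  At a vertex which is not a saddle point the cross is determined by
sigma, and every vertex which is not internal is a saddle point whose cross is
open by the boundary condition.  At each internal saddle point the three
values of the cross may be chosen freely, with weights 1, alpha, 1.  Hence the
weight is c ^ #saddle(sigma), where c = 2 + alpha, times the probability of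
eta under independent choices at the saddle points ([saddle_kernel]).

Fix eta.  As eta has no closed cross, every sigma compatible with eta satisfies
the ice rule ([compatible_ice_rule]), so that the admissible sigma are
the colourings of the clusters of eta which take the prescribed values on the
two boundary clusters.  Hence the weight is alpha ^ N(eta) * 2 ^ F(eta), F being
the number of non-boundary clusters, times the probability of sigma under
independent uniform colours ([cluster_kernel]).  Finally F = k - 2, since the
clusters incident to Delta are the free ones and the two boundary clusters
([card_incident_clusters]); the factor 4 is absorbed in the normalisation.

Such a factorisation gives at once the marginal law and the conditional law
([disintegrate_normalize]).

The geometric input is that the internal vertices are those whose cross belongs
to Delta ([internalE], [DeltaE]), and that the faces of each parity on which the
spins are prescribed form a single cluster, so that there are exactly two
boundary clusters ([pinned_connected]). *)

(** * Weights with finite support *)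

Lemma fsum_fibers (R : realType) (T U : choiceType) (f : T -> U) (P : T -> R) :
  finite_set [set x | P x != 0] ->
  \sum_(y \in setT) \sum_(x \in f @^-1` [set y]) P x = \sum_(x \in setT) P x.
Proof.
move=> finP; pose S := [set x | P x != 0].
have PS x : ~ S x -> P x = 0 by move=> /negP/negPn/eqP.
have fib y : \sum_(x \in f @^-1` [set y]) P x =
    \sum_(x \in S) if f x == y then P x else 0.
  rewrite fsbig_mkcond [RHS]fsbig_mkcond; apply: eq_fsbigr => x _.
  rewrite /patch; have [/set_mem/= ->|] := boolP (x \in f @^-1` _).
    rewrite eqxx; have [//|nSx] := boolP (x \in S).
    by apply: PS; rewrite -notin_setE.
  by rewrite notin_setE /= => /eqP/negPf ->; rewrite if_same.
under eq_fsbigr do rewrite fib.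
rewrite -(@fsbig_widen _ _ _ _ (f @` S)) //; last first.
  move=> y [_ nSy] /=; apply: fsbig1 => x Sx.
  by case: eqP => // fxy; case: nSy; exists x.
rewrite exchange_fsbig //; last exact: finite_image.
rewrite -[RHS](@fsbig_widen _ _ _ _ S) //; last by move=> x [_ /PS].
apply: eq_fsbigr => x /set_mem Sx.
rewrite -(@fsbig_widen _ _ _ _ [set f x]) ?fsbig_set1 ?eqxx //.
  by move=> _ ->; exists x.
by move=> y [_ /= /eqP]; rewrite eq_sym => /negPf ->.
Qed.

(** The sum of the weight over the fibre of [x] is [a x], because [K x] has mass
one; so a single factorisation of the weight gives both the law of [f] and the
conditional law given [f].  The map [h x] parametrizes the fibre over [x],
which lets the same lemma serve the two projections of a product. *)
Lemma disintegrate_normalize (R : realType) (V T U : choiceType) (f : V -> T)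
    (h : T -> U -> V) (w : V -> R) (a : T -> R) (K : T -> U -> R) :
  (forall x, set_bij setT (f @^-1` [set x]) (h x)) ->
  finite_set [set v | w v != 0] ->
  (forall x y, w (h x y) = a x * K x y) ->
  (forall x, a x != 0 -> \sum_(y \in setT) K x y = 1) ->
  pmf_map f (normalize w) =1 normalize a
  /\ (\sum_(v \in setT) w v != 0 -> forall x, a x != 0 -> forall y,
       normalize w (h x y) / pmf_map f (normalize w) x = K x y).
Proof.
move=> hbij finw wE K1.
have fibE x : \sum_(v \in f @^-1` [set x]) w v = a x.
  rewrite (reindex_fsbig (h x) setT); last exact: hbij.
  under eq_fsbigr do rewrite wE.
  rewrite -mulr_fsumr; have [->|/K1->] := eqVneq (a x) 0; first by rewrite mul0r.
  by rewrite mulr1.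
have totE : \sum_(v \in setT) w v = \sum_(x \in setT) a x.
  by rewrite -(fsum_fibers f finw); apply: eq_fsbigr => x _; rewrite fibE.
have margE x : pmf_map f (normalize w) x = (\sum_(v \in setT) w v)^-1 * a x.
  by rewrite /pmf_map /normalize -mulr_fsumr fibE.
split=> [x|Z0 x a0 y]; first by rewrite margE totE.
rewrite margE /normalize wE invfM mulrACA divff ?invr_neq0 //.
by rewrite mulrAC divff // !mul1r.
Qed.

Lemma normalize_is_pmf (R : realType) (T : choiceType) (w : T -> R) :
  (forall x, 0 <= w x) -> \sum_(x \in setT) w x != 0 -> is_pmf (normalize w).
Proof.
move=> w0 Z0; split=> [x|]; first by rewrite mulr_ge0 // invr_ge0 fsumr_ge0.
by rewrite /normalize -mulr_fsumr mulVf.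
Qed.

Lemma normalizeZ (R : realType) (T : choiceType) (k : R) (w : T -> R) :
  k != 0 -> normalize (fun x => k * w x) =1 normalize w.
Proof.
move=> k0 x; rewrite /normalize -mulr_fsumr invfM mulrACA.
by rewrite mulVf // mul1r.
Qed.

Lemma fsum_neq0 (R : realType) (T : choiceType) (w : T -> R) (x : T) :
  finite_set [set x | w x != 0] -> (forall x, 0 <= w x) -> w x != 0 ->
  \sum_(x \in setT) w x != 0.
Proof.
move=> finw w0 wx; pose S := [set x | w x != 0].
rewrite -(@fsbig_widen _ _ _ _ S) //; last by move=> y [_ /negP/negPn/eqP].
apply/eqP => /(pfsumr_eq0 finw (fun i _ => w0 i)) /(_ x wx) /eqP.
by rewrite (negPf wx).
Qed.

(** The configurations which agree with [t] outside of the finite set [B] are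
encoded by the functions on [B], over which sums are ordinary finite sums. *)
Definition extend (I : choiceType) (S : finType) (t : I -> S) (B : {fset I})
    (g : {ffun B -> S}) : I -> S :=
  fun x => if insub x is Some y then g y else t x.

Lemma extend_bij (I : choiceType) (S : finType) (t : I -> S) (B : {fset I}) :
  set_bij [set: {ffun B -> S}] [set f | forall x, x \notin B -> f x = t x]
    (@extend I S t B).
Proof.
split=> [g _ x xB| g g' _ _ gg'|f fB].
- by rewrite /extend insubN.
- apply/ffunP => y; have := congr1 (@^~ (val y)) gg'.
  by rewrite /extend valK.
exists [ffun y => f (val y)] => //; apply/funext => x.
rewrite /extend; case: insubP => [y _ <-|/fB //].
by rewrite ffunE.
Qed.

Lemma finite_off_finite (I : choiceType) (S : finType) (t : I -> S)
    (A : set I) :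
  finite_set A -> finite_set [set f : I -> S | forall x, ~ A x -> f x = t x].
Proof.
move=> finA; apply: sub_finite_set (finite_image (@extend I S t (fset_set A))
  (@finite_finset _ setT)) => f fA.
have [_ _ + ] := extend_bij t (fset_set A); apply => x /=.
by rewrite in_fset_set // notin_setE => /fA.
Qed.

Lemma prod_pmf_eq0 (R : realType) (I S : choiceType) (A : set I) (s0 : S)
    (p : S -> R) (f : I -> S) :
  prod_pmf A s0 p f != 0 -> forall x, ~ A x -> f x = s0.
Proof.
rewrite /prod_pmf indicE; have [|_] := boolP (f \in _).
  by rewrite in_setE.
by rewrite mul0r eqxx.
Qed.

Lemma prod_pmfE (R : realType) (I S : choiceType) (A : set I) (s0 : S)
    (p : S -> R) (f : I -> S) :
  finite_set A -> (forall x, ~ A x -> f x = s0) ->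
  prod_pmf A s0 p f = \prod_(x <- fset_set A) p (f x).
Proof.
move=> finA fA; rewrite /prod_pmf indicE mem_set // mul1r.
by rewrite fsbig_finite.
Qed.

(** Distributivity: the sum over all families of a product over the coordinates
is the product of the sums over each coordinate. *)
Lemma prod_pmf_total (R : realType) (I : choiceType) (S : finType) (A : set I)
    (s0 : S) (p : S -> R) :
  finite_set A -> \sum_s p s = 1 ->
  \sum_(f \in setT) prod_pmf A s0 p f = 1.
Proof.
move=> finA p1; pose B := fset_set A.
pose E := [set f : I -> S | forall x, x \notin B -> f x = s0].
have EP f : E f <-> forall x, ~ A x -> f x = s0.
  by split=> h x; have := h x; rewrite /B in_fset_set // notin_setE.
rewrite -(@fsbig_widen _ _ _ _ E) //; last first.
  move=> f [_ nE] /=; apply/eqP; apply: contra_notT nE => /prod_pmf_eq0.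
  by move/EP.
rewrite (reindex_fsbig (@extend I S (fun=> s0) B) setT); last exact: extend_bij.
transitivity (\sum_(g : {ffun B -> S}) \prod_(y : B) p (g y)).
  rewrite [RHS]bigfs ?index_enum_uniq //; last first.
    by move=> g _; rewrite mem_index_enum.
  rewrite (_ : [set` _] = setT); last by apply/seteqP; split.
  apply: eq_fsbigr => g _; rewrite prod_pmfE //; last first.
    apply/EP; have [+ _ _] := extend_bij (fun=> s0) B.
    by move/(_ g Logic.I).
  rewrite -/B big_seq_fsetE; apply: eq_bigr => y _.
  by rewrite /extend valK.
by rewrite -(bigA_distr_bigA (fun=> p)) big1.
Qed.

Lemma pmf_map_total (R : realType) (T U : choiceType) (f : T -> U) (P : T -> R) :
  \sum_(x \in setT) P x = 1 -> \sum_(y \in setT) pmf_map f P y = 1.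
Proof.
move=> P1; rewrite -P1; apply: fsum_fibers; apply: contrapT => infP.
have : \sum_(x \in setT) P x = 0.
  apply: fsbig_dflt => finP; apply: infP; apply: sub_finite_set finP => x /= px.
  by split=> //; apply/eqP.
by rewrite P1 => /eqP; rewrite oner_eq0.
Qed.

(** For the two samplings considered here the random choices can be read off
from the resulting configuration, so that a single preimage contributes. *)
Lemma pmf_map_atom (R : realType) (T U : choiceType) (f : T -> U) (P : T -> R)
    (y : U) (x0 : T) :
  (forall x, P x != 0 -> f x = y -> x = x0) ->
  pmf_map f P y = if f x0 == y then P x0 else 0.
Proof.
move=> uniq; rewrite /pmf_map; case: ifPn => [/eqP fx0|/eqP fx0].
  rewrite -(@fsbig_widen _ _ _ _ [set x0]) ?fsbig_set1 //; first by move=> _ ->.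
  move=> x [/= fx xx0]; apply/eqP; apply: contra_notT xx0 => px.
  exact: uniq.
apply: fsbig1 => x /= fx; apply/eqP; apply: contra_notT fx0 => px.
by rewrite -(uniq x).
Qed.

(** * The diamond domain in coordinates *)

Definition l1 (u v : int * int) : int := `|u.1 - v.1| + `|u.2 - v.2|.

Lemma rt_invariant (T : Type) (r : T -> T -> Prop) (P : T -> Prop) (x y : T) :
  (forall a b, P a -> r a b -> P b) -> clos_refl_trans T r x y -> P x -> P y.
Proof. by move=> step; elim=> {x y} [x y|x|x y z _ IH1 _ IH2]; eauto. Qed.

Lemma path_nn_l1 (u : face) (p : seq face) :
  path nn u p -> l1 u (last u p) <= (size p)%:Z.
Proof.
elim: p u => [|w p IH] u /=; first by rewrite /l1; lia.
case/andP; rewrite /nn => uw /IH; rewrite /l1.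
move: (last w p) uw => [z1 z2]; case: u w {IH} => [u1 u2] [w1 w2] /=; lia.
Qed.

Lemma l1_path (k : nat) (u v : face) :
  l1 u v = k -> exists2 p, path nn u p & last u p = v /\ size p = k.
Proof.
elim: k u => [|k IH] u.
  rewrite /l1 => h; exists [::] => //=; split=> //.
  by case: u v h => [u1 u2] [v1 v2] /= h; congr pair; lia.
move=> h; suff [w uw /IH[p pp [lp sp]]] : exists2 w, nn u w & l1 w v = k.
  by exists (w :: p); rewrite /= ?uw ?lp ?sp.
case: u v h {IH} => [u1 u2] [v1 v2]; rewrite /l1 /nn /= => h.
have [a|b|e] := ltgtP u1 v1.
- exists (u1 + 1, u2) => /=; lia.
- exists (u1 - 1, u2) => /=; lia.
have [a|b|e'] := ltgtP u2 v2.
- exists (u1, u2 + 1) => /=; lia.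
- exists (u1, u2 - 1) => /=; lia.
lia.
Qed.

Lemma distE (u v : face) (k : nat) : dist u v k <-> l1 u v = k.
Proof.
split=> [[[p pp [lp sp]] m]|h].
  have := path_nn_l1 pp; rewrite lp sp => le.
  have [|p' pp' [lp' sp']] := @l1_path `|l1 u v|%N u v; first by rewrite /l1; lia.
  by have := m _ pp' lp'; rewrite sp'; rewrite /l1 in le *; lia.
split=> [|p pp lp]; first exact: l1_path.
by have := path_nn_l1 pp; rewrite lp h lez_nat.
Qed.

Lemma domainE (D : diamond) (u : face) :
  domain D u <-> l1 u (center D) <= (radius D)%:Z.
Proof.
split=> [[k kn /distE ->]|h]; first by rewrite lez_nat.
exists `|l1 u (center D)|%N; first by rewrite /l1 in h *; lia.
by apply/distE; rewrite /l1; lia.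
Qed.

(** Twice the distance from a vertex to the centre of the diamond: the vertex
[x] lies at [x - (1/2, 1/2)] in the coordinates of the faces, and doubling keeps
this an integer.  If the value is [2 s], the faces around [x] are at distance
[s - 1], [s], [s], [s + 1] from the centre.  Below, [n] denotes the radius. *)
Definition l1_double (D : diamond) (x : Z2) : int :=
  `|2 * (x.1 - (center D).1) - 1| + `|2 * (x.2 - (center D).2) - 1|.

Local Notation rad D := ((radius D)%:Z).

(** An inner and an outer boundary face meet at a vertex at distance [s] from the
centre when [n] and [n + 1] both occur among [s - 1], [s], [s + 1], which leaves
[s = n] and [s = n + 1]. *)
Lemma on_circuitE (D : diamond) (x : Z2) :
  on_circuit D x <-> l1_double D x = 2 * rad D \/ l1_double D x = 2 * rad D + 2.
Proof.
rewrite /on_circuit /circuit_edge /inner_boundary /outer_boundary /l1_double /=.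
have := radius_gt0 D.
case: D => [[c1 c2] n _ /= _ _] n0; case: x => [a b] /=.
split.
  case=> y [_ [u [w [/distE + /distE + [xu xw] _]]]].
  rewrite /l1 /= => hu hw.
  move: xu xw hu hw; rewrite /faces_at /face_ne /face_nw /face_sw /face_se /=.
  by case=> [[[|]|]|] -> ; case=> [[[|]|]|] -> /=; lia.
have wit A r1 r2 : A = a \/ A = a - 1 -> r1 = b \/ r1 = b - 1 ->
    r2 = b \/ r2 = b - 1 -> l1 (A, r1) (c1, c2) = n ->
    l1 (A, r2) (c1, c2) = n.+1 ->
    exists y, nn (a, b) y /\ exists u w, [/\ dist u (c1, c2) n,
      dist w (c1, c2) n.+1, faces_at (a, b) u /\ faces_at (a, b) w
      & faces_at y u /\ faces_at y w].
  (* The faces [(A, b)] and [(A, b - 1)] share the horizontal edge from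
     [(a, b)] to its neighbour on the side of column [A]. *)
  move=> eA e1 e2 h1 h2; exists (2 * A + 1 - a, b).
  split; first by rewrite /nn /=; lia.
  exists (A, r1), (A, r2); split; try exact/distE.
    by rewrite /faces_at /face_ne /face_nw /face_sw /face_se /=;
      case: eA e1 e2 => -> [] -> [] ->; split; tauto.
  rewrite /faces_at /face_ne /face_nw /face_sw /face_se /=.
  case: eA => ->.
    have -> : 2 * a + 1 - a - 1 = a by lia.
    by case: e1 e2 => -> [] ->; split; tauto.
  have -> : 2 * (a - 1) + 1 - a = a - 1 by lia.
  by case: e1 e2 => -> [] ->; split; tauto.
rewrite /l1 /= in wit.
(* Both faces lie in the same column, the outer one in the row farther from the
   centre: in the column away from the centre if [s = n], and in the one towards
   it if [s = n + 1]. *)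
case=> h; have [ca|ca] := ltP c1 a; have [cb|cb] := ltP c2 b;
  [ apply: (wit a (b - 1) b) | apply: (wit a b (b - 1))
  | apply: (wit (a - 1) (b - 1) b) | apply: (wit (a - 1) b (b - 1))
  | apply: (wit (a - 1) (b - 1) b) | apply: (wit (a - 1) b (b - 1))
  | apply: (wit a (b - 1) b) | apply: (wit a b (b - 1)) ]; lia.
Qed.

Lemma finite_box (m : int) (c : int * int) :
  finite_set [set x : int * int | l1 x c <= m].
Proof.
pose k := `|m|%N; pose h (z : 'I_(k.*2.+1) * 'I_(k.*2.+1)) : int * int :=
  (c.1 - k%:Z + z.1%:Z, c.2 - k%:Z + z.2%:Z).
apply: sub_finite_set (finite_image h (@finite_finset _ setT)) => -[a b].
case: c @h => [c1 c2] h /=; rewrite /l1 /= => le.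
have ha : (absz (a - (c1 - k%:Z))%R < k.*2.+1)%N by lia.
have hb : (absz (b - (c2 - k%:Z))%R < k.*2.+1)%N by lia.
exists (Ordinal ha, Ordinal hb) => //; rewrite /h /=; congr pair; lia.
Qed.

(** The distance to the centre changes by at most one along an edge, so a path
cannot jump over the two layers [s = n] and [s = n + 1] of the circuit.  From a
vertex beyond them, a horizontal ray pointing away from the centre never meets
the circuit. *)
Lemma enclosedE (D : diamond) (x : Z2) :
  enclosed D x <-> l1_double D x < 2 * rad D.
Proof.
rewrite /enclosed /=; split=> [[xc fin]|xn].
  rewrite ltNge; apply/negP => le; apply: infinite_nat.
  have xbig : 2 * rad D + 4 <= l1_double D x.
    by move/on_circuitE: xc; move: le; rewrite /l1_double; lia.
  pose sg : int := if (center D).1 < x.1 then 1 else -1.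
  have sgE : (sg = 1 /\ (center D).1 < x.1) \/ (sg = -1 /\ x.1 <= (center D).1).
    by rewrite /sg; case: ltP; auto.
  pose y (k : nat) : Z2 := (x.1 + sg * k%:Z, x.2).
  have yinj : set_inj setT y.
    by move=> k l _ _ /= []; case: sgE => -[-> _]; lia.
  have : finite_set (y @` setT).
    apply: sub_finite_set fin => _ [k _ <-] /=.
    elim: k => [|k IH].
      rewrite (_ : y 0 = x); first exact: rt_refl.
      by rewrite /y mulr0 addr0; case: (x).
    apply: rt_trans IH _; apply: rt_step; split.
      by rewrite /nn /y /=; case: sgE => -[-> _]; lia.
    move=> /on_circuitE; move: xbig; rewrite /l1_double /y /=.
    by case: sgE => -[-> ?]; lia.
  by rewrite (eq_finite_set (card_esym (inj_card_eq yinj))).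
split; first by move/on_circuitE; move: xn; rewrite /l1_double; lia.
apply: sub_finite_set (finite_box (rad D + 2) (center D)) => z /= xz.
suff : l1_double D z < 2 * rad D by rewrite /l1_double /l1; lia.
apply: (rt_invariant (P := fun z => l1_double D z < 2 * rad D) _ xz xn).
move=> a b an [ab] /on_circuitE; move: an ab.
by rewrite /l1_double /nn; lia.
Qed.

(** The vertices on or inside the circuit are those with [s <= n + 1], and every
vertex of the last layer [s = n + 1] has a neighbour with [s = n + 2]. *)
Lemma internalE (D : diamond) (x : Z2) :
  internal D x <-> l1_double D x <= 2 * rad D.
Proof.
have hatE y : hat_vertex D y <-> l1_double D y <= 2 * rad D + 2.
  rewrite /hat_vertex /setU /= on_circuitE enclosedE.
  by rewrite /l1_double; lia.
split=> [[/hatE xn hx]|xn].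
  rewrite leNgt; apply/negP => lt.
  pose sg : int := if (center D).1 < x.1 then 1 else -1.
  have sgE : (sg = 1 /\ (center D).1 < x.1) \/ (sg = -1 /\ x.1 <= (center D).1).
    by rewrite /sg; case: ltP; auto.
  have [|_ _ /hatE] := hx (x.1 + sg, x.2).
    by rewrite /nn /=; case: sgE => -[-> _]; lia.
  by move: xn lt; rewrite /l1_double /=; case: sgE => -[-> ?]; lia.
split; first by apply/hatE; lia.
move=> y xy; split=> //; apply/hatE; first by lia.
by move: xn xy; rewrite /l1_double /nn; lia.
Qed.

(** The two primal faces at a vertex at distance [s] are both at distance [s] if
[s] is even, and at distances [s - 1] and [s + 1] if [s] is odd.  As [n] is even,
they both lie in the domain exactly when [s <= n]. *)
Lemma DeltaE (D : diamond) (d : edge) : Delta D d <-> internal D (mid d).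
Proof.
have pairE (u w : face) :
    [set u; w] `<=` domain D <-> domain D u /\ domain D w.
  split=> [h|[du dw] _ [->|->] //]; first by split; apply: h; [left|right].
rewrite internalE /Delta /l1_double /=; move: (mid d) (center_primal D) (radius_even D).
case=> a b; case E: (center D) => [c1 c2]; rewrite /primal /= => cp n2.
case: ifP; rewrite pairE !domainE E /l1 /face_ne /face_nw /face_sw /face_se /=;
  lia.
Qed.

(** The faces where the boundary condition prescribes the spin.  A dual face is at
odd distance from the centre, so for it the inequality says [n + 1 <= l1]:
one inequality describes the inner boundary together with the complement of the
domain. *)
Definition pinned (D : diamond) : set face :=
  [set u | rad D <= l1 u (center D)].

Lemma l1_parity (D : diamond) (u : face) :
  primal u = (2 %| l1 u (center D))%Z.
Proof.
by move: (center_primal D); rewrite /primal /l1; lia.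
Qed.

Lemma ends_pinned (D : diamond) (d : edge) (u : face) :
  ~ Delta D d -> ends d u -> pinned D u.
Proof.
rewrite DeltaE internalE /l1_double /pinned /=.
move: (center_primal D) (radius_even D).
case E: (center D) => [c1 c2]; rewrite /primal /l1 /= => cp n2.
by case: d => -[a b] /= nD; case: ifP => pr [] -> /=; move: pr nD;
  rewrite /primal /=; lia.
Qed.

(** A diagonal step between two faces crosses the vertex between them, which is
not internal unless one of the faces is at distance less than [n] or both are at
distance [n]. *)
Lemma open_adj_pinned (D : diamond) (e : SI_config) (u w : face) :
  Omega_SI_bc (Delta D) wired e -> pinned D u -> pinned D w ->
  `|u.1 - w.1| = 1 -> `|u.2 - w.2| = 1 ->
  rad D + 1 <= l1 u (center D) \/ rad D + 1 <= l1 w (center D) ->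
  open_adj e u w.
Proof.
move=> [_ ebc] ub wb h1 h2 h.
have /ends_diag [uw [d dE]] : (`|u.1 - w.1| == 1) && (`|u.2 - w.2| == 1).
  by rewrite h1 h2.
have du : ends d u by rewrite dE; left.
have dw : ends d w by rewrite dE; right.
exists d; split => //; rewrite ebc // DeltaE internalE /l1_double.
case: d {dE} du dw => -[a b] /=; case: ifP => _ [] uE [] wE;
  move: ub wb h h1 h2; rewrite /pinned /l1 uE wE
    /face_ne /face_nw /face_sw /face_se /=; lia.
Qed.

(** * Clusters of the prescribed region *)

Lemma open_adj_sym (e : SI_config) (u w : face) :
  open_adj e u w -> open_adj e w u.
Proof. by case=> d [ed du dw]; exists d. Qed.

Lemma cluster_refl (e : SI_config) (u : face) : cluster e u u.
Proof. exact: rt_refl. Qed.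

Lemma cluster_sym (e : SI_config) (u w : face) : cluster e u w -> cluster e w u.
Proof.
elim=> {u w} [u w uw|u|u w z _ wu _ zw]; last exact: rt_trans zw wu.
- by apply: rt_step; exact: open_adj_sym.
- exact: rt_refl.
Qed.

Lemma cluster_eqP (e : SI_config) (u w : face) :
  cluster e u = cluster e w <-> cluster e u w.
Proof.
split=> [->|uw]; first exact: cluster_refl.
apply/seteqP; split=> z; last exact: rt_trans.
by apply: rt_trans; exact: cluster_sym.
Qed.

Lemma cluster_primal (e : SI_config) (u w : face) :
  cluster e u w -> primal w = primal u.
Proof.
move=> uw; apply: (rt_invariant (P := fun z => primal z = primal u) _ uw) => //.
by move=> a b <- [d [_ /ends_parity -> /ends_parity ->]].
Qed.

(** On a diagonal line the quantity [u.1 - t * u.2] is constant, and its absolute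
value relative to the centre bounds the distance from below, so the
whole line avoids the domain. *)
Lemma cluster_pinned_line (D : diamond) (e : SI_config) (u : face) (t k : int) :
  Omega_SI_bc (Delta D) wired e -> t = 1 \/ t = -1 ->
  rad D + 1 <= `|(u.1 - (center D).1) - t * (u.2 - (center D).2)| ->
  cluster e u (u.1 + k, u.2 + t * k).
Proof.
move=> ebc t1; suff nonneg (k' : nat) (v : face) :
    rad D + 1 <= `|(v.1 - (center D).1) - t * (v.2 - (center D).2)| ->
    cluster e v (v.1 + k'%:Z, v.2 + t * k'%:Z).
  move=> ut; case: k => k'; first exact: nonneg.
  pose v : face := (u.1 + Negz k', u.2 + t * Negz k').
  have -> : u = (v.1 + k'.+1%:Z, v.2 + t * k'.+1%:Z).
    by case: u @v {ut} => [a b] /=; congr pair; case: t1 => tE; rewrite ?tE; lia.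
  have -> : (v.1 + k'.+1%:Z + Negz k', v.2 + t * k'.+1%:Z + t * Negz k') = v.
    by rewrite /v /=; congr pair; case: t1 => tE; rewrite ?tE; lia.
  apply/cluster_sym/nonneg; move: ut; rewrite /v /=.
  by case: t1 => tE; rewrite ?tE; lia.
move=> vt; elim: k' => [|k' IH].
  by rewrite mulr0 !addr0; case: (v) => a b; exact: cluster_refl.
apply: rt_trans IH _; apply: rt_step; apply: (open_adj_pinned (D := D)) => //;
  move: vt; rewrite /pinned /l1 /=; case: t1 => tE; rewrite ?tE; lia.
Qed.

(** In the coordinates [p = u.1 + u.2] and [q = u.1 - u.2] relative to the centre,
the distance is the maximum of [|p|] and [|q|], and a diagonal step changes one of
the two by 2.  The pinned region is the outside of a square: when [|p|] is large
one may move [q] freely, and vice versa, so every face can be brought to a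
reference face at [p = q = m], in two straight moves.  A primal face at distance
exactly [n] has first to make a step outwards, as two such faces are not
joined directly. *)
Lemma pinned_connected (D : diamond) (e : SI_config) (u w : face) :
  Omega_SI_bc (Delta D) wired e -> pinned D u -> pinned D w ->
  primal u = primal w -> cluster e u w.
Proof.
move=> ebc; pose m (b : bool) : int := rad D + 2 + ~~ b.
pose T b : face := ((center D).1 + m b, (center D).2).
suff reach z : pinned D z -> cluster e z (T (primal z)).
  by move=> /reach uT /reach wT uw; apply: rt_trans uT _; rewrite uw; exact: cluster_sym.
have far v : rad D + 1 <= l1 v (center D) -> cluster e v (T (primal v)).
  move=> vfar; rewrite /T.
  set p := (v.1 - (center D).1) + (v.2 - (center D).2).
  set q := (v.1 - (center D).1) - (v.2 - (center D).2).
  pose k := ((m (primal v) - p) %/ 2)%Z; pose l := ((m (primal v) - q) %/ 2)%Z.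
  have kE : 2 * k = m (primal v) - p.
    by move: (l1_parity D v) (radius_even D); rewrite /k /m /p /l1; lia.
  have lE : 2 * l = m (primal v) - q.
    by move: (l1_parity D v) (radius_even D); rewrite /l /m /q /l1; lia.
  have [pbig|qbig] : rad D + 1 <= `|p| \/ rad D + 1 <= `|q|.
    by move: vfar; rewrite /l1 /p /q; lia.
  - apply: (rt_trans _ _ _ (v.1 + l, v.2 + (-1) * l)).
      apply: (cluster_pinned_line (D := D)); [done|by right|].
      by move: pbig; rewrite /p; lia.
    have -> : ((center D).1 + m (primal v), (center D).2) =
        (v.1 + l + k, v.2 + (-1) * l + 1 * k).
      by congr pair; move: kE lE; rewrite /p /q; lia.
    apply: (@cluster_pinned_line D e (v.1 + l, v.2 + (-1) * l) 1 k ebc).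
      by left.
    by move: lE; rewrite /q /m /=; lia.
  - apply: (rt_trans _ _ _ (v.1 + k, v.2 + 1 * k)).
      apply: (cluster_pinned_line (D := D)); [done|by left|].
      by move: qbig; rewrite /q; lia.
    have -> : ((center D).1 + m (primal v), (center D).2) =
        (v.1 + k + l, v.2 + 1 * k + (-1) * l).
      by congr pair; move: kE lE; rewrite /p /q; lia.
    apply: (@cluster_pinned_line D e (v.1 + k, v.2 + 1 * k) (-1) l ebc).
      by right.
    by move: kE; rewrite /p /m /=; lia.
move=> zb; have [zn|zn] := leP (rad D + 1) (l1 z (center D)); first exact: far.
pose z' : face := (z.1 + (if (center D).1 <= z.1 then 1 else -1),
                   z.2 + (if (center D).2 <= z.2 then 1 else -1)).
have z'far : rad D + 1 <= l1 z' (center D).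
  move: zb; rewrite /pinned /z' /l1 /=;
    have [?|?] := leP (center D).1 z.1; have [?|?] := leP (center D).2 z.2; lia.
have zz' : cluster e z z'.
  apply: rt_step; apply: (open_adj_pinned (D := D)) => //; last by right.
  - by rewrite /pinned /=; lia.
  - by rewrite /z' /=; case: leP; lia.
  - by rewrite /z' /=; case: leP; lia.
apply: rt_trans (zz') _; rewrite -(cluster_primal zz'); exact: far.
Qed.

(** * Boundary conditions and boundary clusters *)

Lemma pinnedE (D : diamond) (u : face) :
  pinned D u <-> inner_boundary D u \/ ~ domain D u.
Proof. by rewrite /inner_boundary /pinned /= distE domainE; lia. Qed.

Lemma outer_boundary_off_domain (D : diamond) (u : face) :
  outer_boundary D u -> ~ domain D u.
Proof. by rewrite /outer_boundary /= distE domainE => ->; lia. Qed.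

(** The three boundary clauses merge into a single one on pinned faces, because
inner boundary faces are primal and outer boundary faces are dual. *)
Lemma Omega_spinE (D : diamond) (i j : bool) (s : spin_config) :
  Omega_spin D i j s <->
  ice_rule s /\ forall u, pinned D u -> s u = if primal u then j else i.
Proof.
have inP u : inner_boundary D u -> primal u.
  by rewrite /inner_boundary /= distE (l1_parity D) => ->; move: (radius_even D); lia.
have outP u : outer_boundary D u -> primal u = false.
  by rewrite /outer_boundary /= distE (l1_parity D) => ->; move: (radius_even D); lia.
split=> [[ice so si sd]|[ice sb]]; split=> // u.
- by case/pinnedE => h; [rewrite si ?inP | exact: sd].
- move=> h; rewrite sb ?outP //.
  by apply/pinnedE; right; exact: outer_boundary_off_domain.
- by move=> h; rewrite sb ?inP //; apply/pinnedE; left.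
- by move=> h; rewrite sb //; apply/pinnedE; right.
Qed.

Lemma primal_boundary_clusterE (D : diamond) (e : SI_config) (C : set face) :
  Omega_SI_bc (Delta D) wired e ->
  primal_boundary_cluster D e C <->
  exists u, [/\ primal u, pinned D u & C = cluster e u].
Proof.
move=> ebc; split=> [[[u pu ->] inC _]|[u [pu ub ->]]].
  pose z : face := ((center D).1 + rad D, (center D).2).
  have zb : inner_boundary D z.
    by rewrite /inner_boundary /= distE /l1 /=; lia.
  have uz := inC _ zb; exists z; split; last exact/cluster_eqP.
    by rewrite (cluster_primal uz).
  by apply/pinnedE; left.
split; first by exists u.
  move=> w wb; apply: (pinned_connected ebc) => //; first by apply/pinnedE; left.
  rewrite pu; move: wb; rewrite /inner_boundary /= distE (l1_parity D) => ->.
  by move: (radius_even D); lia.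
move=> w pw wb; apply: (pinned_connected ebc) => //; last by rewrite pu pw.
by apply/pinnedE; right.
Qed.

Lemma dual_boundary_clusterE (D : diamond) (e : SI_config) (C : set face) :
  Omega_SI_bc (Delta D) wired e ->
  dual_boundary_cluster D e C <->
  exists u, [/\ ~~ primal u, pinned D u & C = cluster e u].
Proof.
move=> ebc; split=> [[[u pu ->] inC _]|[u [pu ub ->]]].
  pose z : face := ((center D).1 + rad D + 1, (center D).2).
  have zb : outer_boundary D z.
    by rewrite /outer_boundary /= distE /l1 /=; lia.
  have uz := inC _ zb; exists z; split; last exact/cluster_eqP.
    by rewrite (cluster_primal uz).
  by apply/pinnedE; right; exact: outer_boundary_off_domain.
split; first by exists u.
  move=> w wb; apply: (pinned_connected ebc) => //; first by
    apply/pinnedE; right; exact: outer_boundary_off_domain.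
  rewrite (negPf pu); move: wb; rewrite /outer_boundary /= distE (l1_parity D) => ->.
  by move: (radius_even D); lia.
move=> w pw wb; apply: (pinned_connected ebc) => //.
  by apply/pinnedE; right.
by rewrite (negPf pu) (negPf pw).
Qed.

(** * Sampling the crosses given the spins *)

Lemma internal_finite (D : diamond) : finite_set (internal D).
Proof.
apply: sub_finite_set (finite_box (rad D + 2) (center D)) => x /internalE /=.
by rewrite /l1_double /l1; lia.
Qed.

Lemma saddle_finite (D : diamond) (s : spin_config) : finite_set (saddle D s).
Proof. exact/finite_setIl/internal_finite. Qed.

(** Both ends of an edge outside Delta are pinned and of the same parity. *)
Lemma constant_off_Delta (D : diamond) (i j : bool) (s : spin_config)
    (d : edge) :
  Omega_spin D i j s -> ~ Delta D d -> constant_on s (ends d).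
Proof.
case/Omega_spinE => _ sb dD u w du dw.
by rewrite !sb ?(ends_parity du) ?(ends_parity dw) //; exact: ends_pinned dD _.
Qed.

Lemma saddle_off_internal (D : diamond) (i j : bool) (s : spin_config)
    (x : Z2) :
  Omega_spin D i j s -> ~ internal D x -> saddle_point s x.
Proof.
by move=> so nx; split; apply: (constant_off_Delta so); rewrite DeltaE.
Qed.

Lemma fill_hat_off_internal (D : diamond) (i j : bool) (s : spin_config)
    (f : Z2 -> bool * bool) (x : Z2) :
  Omega_spin D i j s -> ~ internal D x -> fill_hat D s f x = (true, true).
Proof.
move=> so nx; rewrite /fill_hat (mem_set (saddle_off_internal so nx)) /=.
by rewrite memNset.
Qed.

Lemma hat_fill_edges (D : diamond) (s : spin_config) (f : Z2 -> bool * bool)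
    (x : Z2) : hat (fill_edges D s f) x = fill_hat D s f x.
Proof. by rewrite /hat /=; case: (fill_hat D s f x). Qed.

Lemma fill_hat_saddle (D : diamond) (s : spin_config) (f : Z2 -> bool * bool)
    (x : Z2) : saddle D s x -> fill_hat D s f x = f x.
Proof. by case=> xi xs; rewrite /fill_hat !mem_set. Qed.

Lemma open_crosses_compatible (D : diamond) (s : spin_config) (e : SI_config) :
  compatible s e ->
  open_crosses (Delta D) e = saddle D s `&` [set x | hat e x = (true, true)].
Proof.
move=> se; apply/seteqP; split=> [x [ex xD]|x [[xi _] ex]]; last first.
  by split=> //; left; apply/DeltaE.
have [ep ed] : e (Primal x) /\ e (Dual x) by case: ex => -> ->.
split=> //; split; first by case: xD => /DeltaE.
by split; exact: se.
Qed.

Lemma hat_inj (e e' : SI_config) : hat e =1 hat e' -> e = e'.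
Proof. by move=> ee; apply/funext => -[] x; move: (ee x); rewrite /hat => -[]. Qed.

(** The only choices at the saddle points which can produce the configuration
[e]; off the saddle points they take the default value of [prod_pmf]. *)
Definition hat_on_saddle (D : diamond) (s : spin_config) (e : SI_config) :
    Z2 -> bool * bool :=
  fun x => if x \in saddle D s then hat e x else (true, true).

Lemma fill_edges_hat_on_saddle (D : diamond) (i j : bool) (s : spin_config)
    (e : SI_config) :
  Omega_spin D i j s -> Omega_SI_bc (Delta D) wired e -> compatible s e ->
  fill_edges D s (hat_on_saddle D s e) = e.
Proof.
move=> so [eo ebc] se; apply: hat_inj => x; rewrite hat_fill_edges.
have [xi|xi] := pselect (internal D x); last first.
  by rewrite (fill_hat_off_internal _ so xi) /hat !ebc ?DeltaE.
have [xs|xs] := pselect (saddle_point s x).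
  by rewrite fill_hat_saddle // /hat_on_saddle mem_set.
rewrite /fill_hat memNset //=; have := eo x; rewrite /hat.
have := se (Primal x); have := se (Dual x).
case: asboolP => xp; case: (e (Primal x)); case: (e (Dual x)) => // hd hp h.
- by case: xs; split=> //; exact: hd.
- by case: xs; split=> //; exact: hd.
- by case: xp; exact: hp.
- by case: xp; exact: hp.
Qed.

Lemma fill_edges_SI (D : diamond) (i j : bool) (s : spin_config)
    (f : Z2 -> bool * bool) :
  Omega_spin D i j s -> (forall x, saddle D s x -> f x <> (false, false)) ->
  Omega_SI_bc (Delta D) wired (fill_edges D s f).
Proof.
move=> so f0; split=> [x|d]; last first.
  rewrite DeltaE => /(fill_hat_off_internal f so).
  by case: d => x /= ->.
rewrite hat_fill_edges; have [xs|] := pselect (saddle D s x).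
  by rewrite fill_hat_saddle //; exact: f0.
rewrite /fill_hat; case: ifPn => [_ _|]; first by case: asboolP.
move=> /negPn/set_mem xs; case: ifPn => // /set_mem xi.
by case; split.
Qed.

Lemma fill_edges_compatible (D : diamond) (s : spin_config)
    (f : Z2 -> bool * bool) :
  ice_rule s -> compatible s (fill_edges D s f).
Proof.
move=> ice d; have [[sp sd] _|xs] := pselect (saddle_point s (mid d)).
  by case: d sp sd.
have : fill_hat D s f (mid d) =
    if `[< constant_on s (ends (Primal (mid d))) >] then (true, false)
    else (false, true) by rewrite /fill_hat memNset.
case: d xs => x /= xs ->; case: asboolP => // xp _.
by case: (ice x).
Qed.

Lemma saddle_law_sum (R : realType) (alpha : R) :
  2 + alpha != 0 -> \sum_b saddle_law alpha b = 1.
Proof.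
move=> a0; transitivity (\sum_x \sum_y saddle_law alpha (x, y)).
  by rewrite pair_bigA /=; apply: eq_bigr => -[].
by rewrite !big_bool /=; field.
Qed.

Lemma prod_cst_fset (R : comNzRingType) (I : choiceType) (k : R)
    (A : {fset I}) : \prod_(x <- A) k = k ^+ #|` A|.
Proof. by rewrite big_const_seq count_predT iter_mulr_1. Qed.

(** Given the spins, each saddle point contributes [2 + alpha] times the
probability of its cross, that is, [alpha] for an open cross and 1 for the
others; the open crosses in Delta all sit at saddle points. *)
Lemma saddle_kernel (R : realType) (alpha : R) (D : diamond) (i j : bool)
    (s : spin_config) (e : SI_config) :
  2 + alpha != 0 -> Omega_spin D i j s ->
  (2 + alpha) ^+ #|` fset_set (saddle D s)| *
    pmf_map (fill_edges D s)
      (prod_pmf (saddle D s) (true, true) (saddle_law alpha)) e =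
  if `[< Omega_SI_bc (Delta D) wired e /\ compatible s e >]
  then alpha ^+ #|` fset_set (open_crosses (Delta D) e)| else 0.
Proof.
move=> a0 so; have finS := saddle_finite D s.
have off x : ~ saddle D s x -> hat_on_saddle D s e x = (true, true).
  by move=> nx; rewrite /hat_on_saddle memNset.
rewrite (@pmf_map_atom _ _ _ _ _ _ (hat_on_saddle D s e)); last first.
  move=> f pf fe; apply/funext => x; rewrite /hat_on_saddle; case: ifPn.
    by move/set_mem => xs; rewrite -fe hat_fill_edges fill_hat_saddle.
  by rewrite notin_setE => /(prod_pmf_eq0 pf).
case: asboolP => [[ebc se]|nA].
  rewrite (fill_edges_hat_on_saddle so) // eqxx prod_pmfE //.
  rewrite (open_crosses_compatible D se) -!prod_cst_fset -!fsbig_finite //; last first.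
    exact: finite_setIl.
  rewrite [in RHS]fsbig_mkcondr -fsbig_split //; apply: eq_fsbigr => x xs.
  have -> : (x \in [set x | hat e x = (true, true)]) = (hat e x == (true, true)).
    by apply/idP/eqP; rewrite in_setE.
  rewrite /hat_on_saddle xs; move: (ebc.1 x).
  by case: (hat e x) => -[] [] //= _; rewrite [LHS]mulrC divfK.
case: eqP => [fe|_]; last by rewrite mulr0.
apply/eqP; apply: contra_notT nA; rewrite mulf_eq0 => /norP[_ pf].
rewrite -fe; split; last by apply: fill_edges_compatible; case/Omega_spinE: so.
apply: (fill_edges_SI so) => x xs fx; move: pf; rewrite prod_pmfE // -fsbig_finite //.
by rewrite (fsbigD1 x) //= fx /= mul0r eqxx.
Qed.

(** * Sampling the spins given the crosses *)

Lemma compatible_cluster (s : spin_config) (e : SI_config) (u w : face) :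
  compatible s e -> cluster e u w -> s w = s u.
Proof.
move=> se uw; apply: (rt_invariant (P := fun z => s z = s u) _ uw) => //.
by move=> a b <- [d [ed da db]]; exact: se ed _ _ db da.
Qed.

(** A pinned face is connected to all pinned faces of its parity, hence to a
whole boundary cluster. *)
Lemma free_clusterE (D : diamond) (e : SI_config) (u : face) :
  Omega_SI_bc (Delta D) wired e ->
  free_clusters D e (cluster e u) <-> forall w, cluster e u w -> ~ pinned D w.
Proof.
move=> ebc; split=> [[_ np nd] w uw wb|h].
  have uwE : cluster e u = cluster e w by exact/cluster_eqP.
  have [pw|pw] := boolP (primal w).
    by apply: np; apply/(primal_boundary_clusterE _ ebc); exists w.
  by apply: nd; apply/(dual_boundary_clusterE _ ebc); exists w.
split; first by exists u.
  case/(primal_boundary_clusterE _ ebc) => w [_ wb uw].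
  by apply: h wb; rewrite uw; exact: cluster_refl.
case/(dual_boundary_clusterE _ ebc) => w [_ wb uw].
by apply: h wb; rewrite uw; exact: cluster_refl.
Qed.

Lemma free_clusters_finite (D : diamond) (e : SI_config) :
  Omega_SI_bc (Delta D) wired e -> finite_set (free_clusters D e).
Proof.
move=> ebc; apply: sub_finite_set (finite_image (cluster e)
  (finite_box (rad D) (center D))) => C fC.
have [[u CE] _ _] := fC; exists u => //=.
move: fC; rewrite CE => /(free_clusterE _ ebc) /(_ u (cluster_refl _ _)).
by rewrite /pinned /=; lia.
Qed.

Lemma color_clusters_pinned (D : diamond) (i j : bool) (e : SI_config)
    (f : set face -> bool) (u : face) :
  Omega_SI_bc (Delta D) wired e -> pinned D u ->
  color_clusters D i j e f u = if primal u then j else i.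
Proof.
move=> ebc ub; rewrite /color_clusters /=; have [pu|pu] := boolP (primal u).
  rewrite asboolT //; apply/(primal_boundary_clusterE _ ebc).
  by exists u.
case: asboolP => [/(primal_boundary_clusterE _ ebc) [w [pw _]]|_].
  by move/cluster_eqP/cluster_primal; rewrite pw (negPf pu).
rewrite asboolT //; apply/(dual_boundary_clusterE _ ebc).
by exists u.
Qed.

Lemma color_clusters_free (D : diamond) (i j : bool) (e : SI_config)
    (f : set face -> bool) (u : face) :
  free_clusters D e (cluster e u) ->
  color_clusters D i j e f u = f (cluster e u).
Proof.
by case=> _ np nd; rewrite /color_clusters; do 2 case: asboolP => // _.
Qed.

Lemma color_clusters_compatible (D : diamond) (i j : bool) (e : SI_config)
    (f : set face -> bool) : compatible (color_clusters D i j e f) e.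
Proof.
move=> d ed u w du dw; rewrite /color_clusters.
suff -> : cluster e u = cluster e w by [].
by apply/cluster_eqP; apply: rt_step; exists d.
Qed.

(** At least one edge of each cross is open, and compatibility makes the spins
constant on it. *)
Lemma compatible_ice_rule (s : spin_config) (e : SI_config) :
  Omega_SI e -> compatible s e -> ice_rule s.
Proof.
move=> eo se x; have := eo x; rewrite /hat.
case ep: (e (Primal x)); first by left; exact: se.
by case ed: (e (Dual x)) => // _; right; exact: se.
Qed.

(** The only signs of the free clusters which can produce the spins [s]: on a free
cluster [s] is constant, so the sign is + exactly when [s] is + throughout.  On
the other sets of faces this is the default value of [prod_pmf]. *)
Definition cluster_signs (D : diamond) (e : SI_config) (s : spin_config) :
    set face -> bool :=
  fun C => if C \in free_clusters D e then `[< C `<=` s >] else true.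

Lemma color_clusters_signs (D : diamond) (i j : bool) (e : SI_config)
    (s : spin_config) :
  Omega_SI_bc (Delta D) wired e -> Omega_spin D i j s -> compatible s e ->
  color_clusters D i j e (cluster_signs D e s) = s.
Proof.
move=> ebc /Omega_spinE[_ sb] se; apply/funext => u.
have [fu|nfu] := pselect (free_clusters D e (cluster e u)).
  rewrite color_clusters_free // /cluster_signs mem_set //.
  apply/asboolP/idP => [|su w uw]; first by apply; exact: cluster_refl.
  by rewrite /= (compatible_cluster se uw).
have [w uw wb] : exists2 w, cluster e u w & pinned D w.
  apply: contrapT => nw; apply/nfu/free_clusterE => // w uw wb.
  by apply: nw; exists w.
have := color_clusters_pinned i j (cluster_signs D e s) ebc wb.
rewrite -sb // (compatible_cluster se uw) /color_clusters.
by have -> : cluster e w = cluster e u by apply/cluster_eqP; exact: cluster_sym.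
Qed.

(** Given the crosses, all admissible spin configurations have the same
probability [2 ^- F], [F] being the number of free clusters. *)
Lemma cluster_kernel (R : realType) (D : diamond) (i j : bool)
    (e : SI_config) (s : spin_config) :
  Omega_SI_bc (Delta D) wired e ->
  2 ^+ #|` fset_set (free_clusters D e)| *
    pmf_map (color_clusters D i j e)
      (prod_pmf (free_clusters D e) true (fun _ : bool => 2^-1 : R)) s =
  if `[< Omega_spin D i j s /\ compatible s e >] then 1 else 0.
Proof.
move=> ebc; have finF := free_clusters_finite ebc.
have off C : ~ free_clusters D e C -> cluster_signs D e s C = true.
  by move=> nC; rewrite /cluster_signs memNset.
rewrite (@pmf_map_atom _ _ _ _ _ _ (cluster_signs D e s)); last first.
  move=> f pf fs; apply/funext => C; rewrite /cluster_signs.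
  case: ifPn; last by rewrite notin_setE => /(prod_pmf_eq0 pf).
  move/set_mem => fC; have [[u CE] _ _] := fC.
  have sC w : C w -> s w = f C.
    move=> Cw; have CwE : cluster e w = C.
      by rewrite CE in Cw *; apply/cluster_eqP; exact: cluster_sym.
    by rewrite -fs color_clusters_free CwE.
  apply/idP/asboolP => [fCt w Cw|]; first by rewrite /= sC.
  by move=> Cs; rewrite -(sC u) ?Cs // CE; exact: cluster_refl.
case: asboolP => [[so se]|nA].
  rewrite color_clusters_signs // eqxx prod_pmfE // prod_cst_fset.
  by rewrite -exprMn mulfV ?expr1n ?pnatr_eq0.
case: eqP => [fs|_]; last by rewrite mulr0.
case: nA; rewrite -fs; have ce := color_clusters_compatible; split=> //.
apply/Omega_spinE; split; first exact: compatible_ice_rule ebc.1 (ce _ _ _ _ _).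
by move=> u ub; exact: color_clusters_pinned.
Qed.

(** Each boundary cluster is incident to Delta, through a corner of the diamond:
the cross at [x] below has a primal end at distance [n] and a dual end at distance
[n + 1].  A free cluster has only faces at distance less than [n], around which
all crosses belong to Delta. *)
Lemma card_incident_clusters (D : diamond) (e : SI_config) :
  Omega_SI_bc (Delta D) wired e ->
  #|` fset_set (incident_clusters (Delta D) e)| =
  (#|` fset_set (free_clusters D e)| + 2)%N.
Proof.
move=> ebc; have finF := free_clusters_finite ebc.
pose x : Z2 := ((center D).1 + rad D, (center D).2).
pose y : face := (x.1, x.2 - 1).
have xD d : mid d = x -> Delta D d.
  by rewrite DeltaE internalE => ->; rewrite /l1_double /x /=; move: (radius_gt0 D); lia.
have px : primal x.
  by rewrite (l1_parity D) /x /l1 /=; move: (radius_even D); lia.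
have py : primal y = false.
  by move: px; rewrite /y /primal /=; lia.
have xb : pinned D x by rewrite /pinned /x /l1 /=; lia.
have yb : pinned D y by rewrite /pinned /y /x /l1 /=; lia.
have xyF : cluster e x != cluster e y.
  by apply/eqP => /cluster_eqP/cluster_primal; rewrite px py.
have bE u : pinned D u -> cluster e u = if primal u then cluster e x else cluster e y.
  move=> ub; case: ifPn => pu; apply/cluster_eqP; apply: pinned_connected ebc _ _ _ => //.
    by rewrite px pu.
  by rewrite py (negPf pu).
have nfree u : pinned D u -> ~ free_clusters D e (cluster e u).
  by move=> ub /(free_clusterE _ ebc) /(_ u (cluster_refl _ _)).
have -> : incident_clusters (Delta D) e =
    cluster e x |` (cluster e y |` free_clusters D e).
  apply/seteqP; split=> [C [u [d [_ _ ->]]]|C].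
    have [fu|nfu] := pselect (free_clusters D e (cluster e u)).
      by right; right.
    have [w uw wb] : exists2 w, cluster e u w & pinned D w.
      apply: contrapT => nw; apply/nfu/free_clusterE => // w uw wb.
      by apply: nw; exists w.
    have -> : cluster e u = cluster e w by exact/cluster_eqP.
    by rewrite (bE w wb); case: ifP => _; [left|right; left].
  case=> [->|[->|fC]].
  - exists x, (Primal x); split=> //; first exact: xD.
    by rewrite /= /face_ne px; left.
  - exists y, (Dual x); split=> //; first exact: xD.
    by rewrite /= /face_ne px; right; rewrite /face_se.
  have [[u CE] _ _] := fC.
  have ub : ~ pinned D u.
    by move: fC; rewrite CE => /(free_clusterE _ ebc) /(_ u (cluster_refl _ _)).
  exists u, (if primal u then Primal u else Dual u); split=> //.
    rewrite DeltaE internalE; move: ub; rewrite /pinned /l1 /l1_double /=.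
    by case: ifP => _ /=; lia.
  by case: ifPn => pu; rewrite /= /face_ne; [rewrite pu|rewrite (negPf pu)]; left.
rewrite !fset_setU1 ?finite_setU //.
rewrite !cardfsU1 !inE !in_fset_set // negb_or xyF.
rewrite !memNset; [|exact: nfree..].
by rewrite addn2.
Qed.

(** * The joint weight *)

Definition joint_weight (R : realType) (D : diamond) (i j : bool) (alpha : R)
    (se : spin_config * SI_config) : R :=
  alpha ^+ #|` fset_set (open_crosses (Delta D) se.2)|
    * \1_[set se' : spin_config * SI_config |
           [/\ Omega_spin D i j se'.1, Omega_SI_bc (Delta D) wired se'.2 &
               compatible se'.1 se'.2]] se.

Definition spin_weight (R : realType) (D : diamond) (i j : bool) (c : R)
    (s : spin_config) : R :=
  c ^+ #|` fset_set (saddle D s)| * \1_(Omega_spin D i j) s.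

(** This is the weight of the superimposed model with [q = 2], divided by 4:
the exponent of 2 counts the free clusters only, which is what summing the joint
weight over the spins produces. *)
Definition SI_weight (R : realType) (D : diamond) (alpha : R)
    (e : SI_config) : R :=
  alpha ^+ #|` fset_set (open_crosses (Delta D) e)|
    * 2 ^+ #|` fset_set (free_clusters D e)|
    * \1_(Omega_SI_bc (Delta D) wired) e.

Lemma joint_weightE (R : realType) (D : diamond) (i j : bool) (alpha : R)
    (s : spin_config) (e : SI_config) :
  joint_weight D i j alpha (s, e) =
  if `[< [/\ Omega_spin D i j s, Omega_SI_bc (Delta D) wired e
           & compatible s e] >]
  then alpha ^+ #|` fset_set (open_crosses (Delta D) e)| else 0.
Proof.
rewrite /joint_weight indicE /=; case: asboolP => h.
  by rewrite mem_set ?mulr1.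
by rewrite memNset ?mulr0.
Qed.

Lemma joint_weight_spin (R : realType) (D : diamond) (i j : bool) (alpha : R)
    (s : spin_config) (e : SI_config) :
  2 + alpha != 0 ->
  joint_weight D i j alpha (s, e) =
  spin_weight D i j (2 + alpha) s *
    pmf_map (fill_edges D s)
      (prod_pmf (saddle D s) (true, true) (saddle_law alpha)) e.
Proof.
move=> a0; rewrite joint_weightE /spin_weight indicE.
have [so|so] := pselect (Omega_spin D i j s).
  rewrite mem_set // mulr1 (saddle_kernel _ a0 so).
  by congr (if _ then _ else _); apply/asbool_equiv_eq; split=> [[]|[]].
rewrite memNset // mulr0 mul0r.
by case: asboolP => // -[].
Qed.

Lemma joint_weight_SI (R : realType) (D : diamond) (i j : bool) (alpha : R)
    (s : spin_config) (e : SI_config) :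
  joint_weight D i j alpha (s, e) =
  SI_weight D alpha e *
    pmf_map (color_clusters D i j e)
      (prod_pmf (free_clusters D e) true (fun _ : bool => 2^-1)) s.
Proof.
rewrite joint_weightE /SI_weight indicE.
have [eo|eo] := pselect (Omega_SI_bc (Delta D) wired e).
  rewrite mem_set // mulr1 -mulrA (@cluster_kernel R _ i j _ s eo).
  rewrite (_ : `[< _ >] = `[< Omega_spin D i j s /\ compatible s e >]).
    by case: asboolP; rewrite ?mulr1 ?mulr0.
  by apply/asbool_equiv_eq; split=> [[]|[]].
rewrite memNset // mulr0 mul0r.
by case: asboolP => // -[].
Qed.

Lemma SI_config_finite (D : diamond) :
  finite_set (Omega_SI_bc (Delta D) wired).
Proof.
pose E : set (Z2 -> bool * bool) :=
  [set f | forall x, ~ internal D x -> f x = (true, true)].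
pose un (f : Z2 -> bool * bool) : SI_config :=
  fun d => if d is Primal x then (f x).1 else (f (mid d)).2.
have finE : finite_set E.
  exact: finite_off_finite (fun=> (true, true)) _ (internal_finite D).
apply: sub_finite_set (finite_image un finE) => e [_ ebc].
exists (hat e) => [x nx|]; first by rewrite /hat !ebc ?DeltaE.
by apply/funext => -[].
Qed.

Lemma spin_config_finite (D : diamond) (i j : bool) :
  finite_set (Omega_spin D i j).
Proof.
have := @finite_off_finite _ _ (fun u : face => if primal u then j else i) _
  (finite_box (rad D) (center D)).
apply: sub_finite_set => s /Omega_spinE [_ sb] u /= ub.
by apply: sb; rewrite /pinned /=; lia.
Qed.

Lemma joint_weight_finite (R : realType) (D : diamond) (i j : bool)
    (alpha : R) : finite_set [set se | joint_weight D i j alpha se != 0].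
Proof.
apply: sub_finite_set (finite_setX (spin_config_finite D i j)
  (SI_config_finite D)) => -[s e] /=; rewrite joint_weightE.
by case: asboolP => [[]|]; rewrite ?eqxx.
Qed.

Lemma joint_weight_ge0 (R : realType) (D : diamond) (i j : bool) (alpha : R)
    (se : spin_config * SI_config) :
  0 <= alpha -> 0 <= joint_weight D i j alpha se.
Proof.
by move=> a0; rewrite mulr_ge0 ?exprn_ge0 // indicE ler0n.
Qed.

(** The constant boundary spins extended to each bipartition class are compatible
with the configuration in which all edges are open. *)
Lemma joint_weight_total (R : realType) (D : diamond) (i j : bool) (alpha : R) :
  0 < alpha -> \sum_(se \in setT) joint_weight D i j alpha se != 0.
Proof.
move=> a0; pose s : spin_config := fun u => if primal u then j else i.
have sc d : constant_on s (ends d).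
  by move=> u w du dw; rewrite /s (ends_parity du) (ends_parity dw).
apply: (@fsum_neq0 _ _ _ (s, wired)); first exact: joint_weight_finite.
  by move=> se; apply/joint_weight_ge0/ltW.
rewrite joint_weightE asboolT ?expf_neq0 ?gt_eqF //; split.
- by apply/Omega_spinE; split=> // x; left; exact: sc.
- by split=> // x; rewrite /hat /wired.
- by move=> d _; exact: sc.
Qed.

(** The two boundary clusters contribute the constant factor [2 ^ 2]. *)
Lemma P_SI_normalize (R : realType) (D : diamond) (alpha : R) :
  P_SI (Delta D) wired alpha 2 =1 normalize (SI_weight D alpha).
Proof.
have four : (2 : R) ^+ 2 != 0 by rewrite expf_neq0 ?pnatr_eq0.
rewrite /P_SI => e; rewrite -(normalizeZ (SI_weight D alpha) four).
congr normalize; apply/funext => {}e; rewrite /SI_weight indicE.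
have [eo|eo] := pselect (Omega_SI_bc (Delta D) wired e).
  by rewrite card_incident_clusters // addnC exprD mulrCA -!mulrA.
by rewrite memNset // !mulr0.
Qed.

Theorem proposition5p2 (R : realType) (c alpha : R) (c_gt2 : 2 < c)
    (alphaE : alpha = c - 2) (i j : bool) (D : diamond) :
  [/\ is_coupling (P_joint D i j alpha)
        (P_spin D i j c) (P_SI (Delta D) wired alpha 2),
      forall s, Omega_spin D i j s ->
        cond_snd (P_joint D i j alpha) s =1
        pmf_map (fill_edges D s)
          (prod_pmf (saddle D s) (true, true) (saddle_law alpha)) &
      forall e, Omega_SI_bc (Delta D) wired e ->
        cond_fst (P_joint D i j alpha) e =1
        pmf_map (color_clusters D i j e)
          (prod_pmf (free_clusters D e) true (fun _ : bool => 2^-1))].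
Proof.
have a0 : 0 < alpha by rewrite alphaE subr_gt0.
have c0 : 2 + alpha != 0 by rewrite gt_eqF ?addr_gt0.
have cE : c = 2 + alpha by rewrite alphaE addrC subrK.
have finw := joint_weight_finite D i j alpha.
have tot := joint_weight_total D i j a0.
have fst_bij s : set_bij setT (fst @^-1` [set s])
    (fun e : SI_config => (s : spin_config, e)).
  by split=> [e _ //|e e' _ _ [] //|[s' e] /= <-]; exists e.
have snd_bij e : set_bij setT (snd @^-1` [set e])
    (fun s : spin_config => (s, e : SI_config)).
  by split=> [s _ //|s s' _ _ [] //|[s e'] /= <-]; exists s.
have fill1 s : spin_weight D i j (2 + alpha) s != 0 ->
    \sum_(e \in setT) pmf_map (fill_edges D s)
      (prod_pmf (saddle D s) (true, true) (saddle_law alpha)) e = 1.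
  move=> _; apply/pmf_map_total/prod_pmf_total; first exact: saddle_finite.
  exact: saddle_law_sum.
have color1 e : SI_weight D alpha e != 0 ->
    \sum_(s \in setT) pmf_map (color_clusters D i j e)
      (prod_pmf (free_clusters D e) true (fun _ : bool => 2^-1 : R)) s = 1.
  rewrite /SI_weight indicE => nz; apply/pmf_map_total/prod_pmf_total.
    apply: free_clusters_finite; apply: contrapT => eo.
    by move: nz; rewrite memNset // mulr0 eqxx.
  by rewrite big_bool /= -mulr2n -[LHS]mulr_natr mulVf ?pnatr_eq0.
have [fstE sndE] := disintegrate_normalize fst_bij finw
  (fun s e => joint_weight_spin D i j s e c0) fill1.
have [fstE' sndE'] := disintegrate_normalize snd_bij finw
  (fun e s => joint_weight_SI D i j alpha s e) color1.
split.
- split; first by apply: normalize_is_pmf => // se; apply/joint_weight_ge0/ltW.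
    by rewrite cE; exact: fstE.
  by move=> e; rewrite P_SI_normalize; exact: fstE'.
- move=> s so e; apply: (sndE tot).
  by rewrite /spin_weight indicE mem_set // mulr1 expf_neq0.
move=> e eo s; apply: (sndE' tot).
by rewrite /SI_weight indicE mem_set // mulr1 mulf_neq0 ?expf_neq0 ?gt_eqF.
Qed.
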